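(* Let $C_{1/3}$ be the middle-third Cantor set. Then $$G^4_{AP}(C_{1/3})=G^3_{AP}(C_{1/3})=\left\{3^{-n}:n\in\mathbb N\right\},\qquad \mathbb N=\{1,2,3,\ldots\},$$ and $G^k_{AP}(C_{1/3})=\varnothing$ for every $k\ge5$. Moreover, $G^3_{AP}(C_\varepsilon)=\varnothing$ whenever $1/3<\varepsilon<1$.
   Context: For $0<\varepsilon<1$ put $\lambda=(1-\varepsilon)/2$. The middle-$\varepsilon$ Cantor set $C_\varepsilon\subset[0,1]$ is the attractor of $f_0(x)=\lambda x$ and $f_1(x)=1-\lambda+\lambda x$, i.e. the unique nonempty compact set with $C_\varepsilon=f_0(C_\varepsilon)\cup f_1(C_\varepsilon)$. For compact $C\subset\mathbb R$ and $k\ge2$, $G^k_{AP}(C):=\{t>0:\exists x\in\mathbb R\text{ with }x,x+t,\ldots,x+(k-1)t\in C\}$. *)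

(* Defs.v *)
From HB Require Import structures.
From mathcomp Require Import all_boot all_order all_algebra.
From mathcomp Require Import all_classical all_reals all_analysis.
From mathcomp Require Import ring lra.
Set Implicit Arguments.
Unset Strict Implicit.
Unset Printing Implicit Defensive.
Import Order.TTheory GRing.Theory Num.Theory.
Import numFieldNormedType.Exports.
Local Open Scope classical_set_scope.
Local Open Scope ring_scope.

Definition cantor_ratio (R : realType) (eps : R) : R := (1 - eps) / 2.

Definition cantor_map0 (R : realType) (eps x : R) : R := cantor_ratio eps * x.

Definition cantor_map1 (R : realType) (eps x : R) : R :=
  1 - cantor_ratio eps + cantor_ratio eps * x.

Definition is_cantor_attractor (R : realType) (eps : R) (C : set R) : Prop :=
  [/\ C !=set0, compact C &
      C = cantor_map0 eps @` C `|` cantor_map1 eps @` C].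

(* The default value set0 is never used for 0 < eps < 1: see
   exists_unique_cantor_attractor below. *)
Definition middle_cantor (R : realType) (eps : R) : set R :=
  xget set0 [set C | is_cantor_attractor eps C].

(* G^k_AP(C): steps of the k-term arithmetic progressions contained in C. *)
Definition gAP (R : realType) (k : nat) (C : set R) : set R :=
  [set t | 0 < t /\ exists x, forall j : nat, (j < k)%N -> C (x + t *+ j)].

Lemma cantor_attractor_subset (R : realType) (eps : R) (A B : set R) :
  0 < eps < 1 ->
  is_cantor_attractor eps A -> is_cantor_attractor eps B -> A `<=` B.
Proof.
move=> /andP[e0 e1] [_ cA AE] [[b0 Bb0] cB BE].
pose l := cantor_ratio eps.
have l0 : 0 < l by rewrite /l /cantor_ratio; lra.
have l1 : l < 1 by rewrite /l /cantor_ratio; lra.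
have [M [_ AM]] := compact_bounded cA.
pose N := `|M| + 1 + `|b0|.
have AN a : A a -> `|a - b0| <= N.
  move=> Aa; apply: le_trans (ler_normB _ _) _; rewrite lerD2r.
  by apply: AM => //; rewrite (le_lt_trans (ler_norm M))// ltrDl.
have ABn n : forall a, A a -> exists2 b, B b & `|a - b| <= N * l ^+ n.
  elim: n => [|n IH] a; first by exists b0 => //; rewrite expr0 mulr1 AN.
  rewrite AE => -[] [a' /IH[b Bb ab] <-].
  - exists (cantor_map0 eps b); first by rewrite BE; left; exists b.
    rewrite /cantor_map0 -mulrBr normrM (gtr0_norm l0) exprS mulrCA.
    by rewrite ler_pM2l.
  - exists (cantor_map1 eps b); first by rewrite BE; right; exists b.
    rewrite /cantor_map1 opprD addrACA subrr add0r.
    by rewrite -mulrBr normrM (gtr0_norm l0) exprS mulrCA ler_pM2l.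
have clB : closed B by apply: compact_closed cB; exact: Rhausdorff.
move=> a Aa; apply: clB => U /nbhs_ballP[r /= r0 arU].
have /cvgrPdist_lt/(_ r r0)[n _ /(_ n (leqnn n))] :
    geometric N l @ \oo --> (0 : R).
  by apply: cvg_geometric; rewrite gtr0_norm.
rewrite /geometric /= sub0r normrN => Nr.
have [b Bb ab] := ABn n a Aa; exists b; split => //; apply: arU.
by rewrite /ball /= (le_lt_trans ab)// (le_lt_trans (ler_norm _)).
Qed.

Lemma exists_cantor_attractor (R : realType) (eps : R) :
  0 < eps < 1 -> exists C, is_cantor_attractor eps C.
Proof.
move=> /andP[e0 e1].
pose l := cantor_ratio eps.
have l0 : 0 < l by rewrite /l /cantor_ratio; lra.
have l1 : l < 1 / 2 by rewrite /l /cantor_ratio; lra.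
have lE : cantor_ratio eps = l by [].
pose F (A : set R) := cantor_map0 eps @` A `|` cantor_map1 eps @` A.
pose K n := iter n F [set` `[0, 1]].
have c0 : continuous (cantor_map0 eps : R -> R).
  by move=> x; apply: cvgM; [exact: cvg_cst | exact: cvg_id].
have c1 : continuous (cantor_map1 eps : R -> R).
  move=> x; apply: cvgD; first exact: cvg_cst.
  by apply: cvgM; [exact: cvg_cst | exact: cvg_id].
have cK n : compact (K n).
  elim: n => [|n IH]; first exact: segment_compact.
  by apply: compactU; apply: continuous_compact => //;
    apply: continuous_subspaceT.
have FS A B : A `<=` B -> F A `<=` F B.
  by move=> AB x [] [y /AB By <-]; [left | right]; exists y.
have KS n : K n.+1 `<=` K n.
  elim: n => [|n IH]; last exact: FS.
  move=> x [] [y]; rewrite /K /= !in_itv /= => /andP[y0 y1] <-;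
    rewrite /cantor_map0 /cantor_map1 lE; apply/andP; split; nra.
have K0 n : K n 0.
  elim: n => [|n IH]; first by rewrite /K /= in_itv /= lexx ler01.
  by left; exists 0 => //; rewrite /cantor_map0 mulr0.
pose C := \bigcap_n K n.
have CS n : C `<=` K n by move=> x; apply.
exists C; split; first by exists 0 => n _; exact: K0.
  apply: (subclosed_compact _ (cK 0%N) (CS 0%N)).
  by apply: closed_bigI => n _; apply: compact_closed (cK n);
    exact: Rhausdorff.
apply/seteqP; split => x; last first.
  move=> FCx n _; apply: KS.
  by apply: (FS C (K n)).
move=> Cx.
have K01 n y : K n y -> 0 <= y <= 1.
  elim: n y => [y|n IH y /KS]; [by rewrite /K /= in_itv | exact: IH].
have sep y z : 0 <= y <= 1 -> 0 <= z <= 1 ->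
    cantor_map0 eps y <> cantor_map1 eps z.
  by rewrite /cantor_map0 /cantor_map1 lE; nra.
have [[y Ky yx]|[y Ky yx]] : F (K 0%N) x by exact: (CS 1%N).
- left; exists y => // n _.
  have [[z Kz zx]|[z Kz zx]] : F (K n) x by exact: (CS n.+1).
  + suff -> : y = z by [].
    by apply: (mulfI (lt0r_neq0 l0)); move: yx zx => <-.
  + by case: (sep y z); rewrite ?yx ?zx//; apply: K01; eauto.
- right; exists y => // n _.
  have [[z Kz zx]|[z Kz zx]] : F (K n) x by exact: (CS n.+1).
  + by case: (sep z y); rewrite ?yx ?zx//; apply: K01; eauto.
  + suff -> : y = z by [].
    apply: (mulfI (lt0r_neq0 l0)); apply: (addrI (1 - l)).
    by move: yx zx => <-.
Qed.

Lemma exists_unique_cantor_attractor (R : realType) (eps : R) :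
  0 < eps < 1 -> exists! C, is_cantor_attractor eps C.
Proof.
move=> e01; have [C hC] := exists_cantor_attractor e01.
exists C; split=> // D hD.
by apply/seteqP; split; exact: (cantor_attractor_subset e01).
Qed.

(* Main.v *)
(** Let [l = (1 - eps) / 2], so that the pieces of the Cantor set [C] lie in
    [0, l] and [1 - l, 1].  If [eps >= 1/3], the gap between the pieces is at
    least as long as each piece, so a progression with at least three terms
    meets both pieces only if [l] and the step are both [1/3]; otherwise it
    lies in one piece and rescales to a progression in [C] with step divided
    by [l].  Steps are at most 1, so this rescaling must stop. *)
Require Import Defs.
From HB Require Import structures.
From mathcomp Require Import all_boot all_order all_algebra.
From mathcomp Require Import all_classical all_reals all_analysis.
From mathcomp Require Import ring lra.
Set Implicit Arguments.
Unset Strict Implicit.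
Unset Printing Implicit Defensive.
Import Order.TTheory GRing.Theory Num.Theory.
Import numFieldNormedType.Exports.
Local Open Scope classical_set_scope.
Local Open Scope ring_scope.

(** Applying the second condition [n] times bounds every element of [S] by [M * l ^+ n], which tends
    to 0, against positivity. *)
Lemma expanding_set_empty (R : realType) (l M : R) (S : set R) :
  0 < l < 1 -> (forall t, S t -> 0 < t <= M) ->
  (forall t, S t -> exists2 u, S u & t <= l * u) -> S = set0.
Proof.
move=> /andP[l0 l1] SM Sl; apply/seteqP; split=> // t St.
have tM n : forall u, S u -> u <= M * l ^+ n.
  elim: n => [|n IH] u Su; first by rewrite expr0 mulr1; case/andP: (SM u Su).
  have [v Sv uv] := Sl u Su; apply: le_trans uv _.
  by rewrite exprS mulrCA ler_pM2l // IH.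
have t0 : 0 < t by case/andP: (SM t St).
have /cvgrPdist_lt/(_ t t0)[n _ /(_ n (leqnn n))] :
    geometric M l @ \oo --> (0 : R).
  by apply: cvg_geometric; rewrite gtr0_norm.
rewrite /geometric /= sub0r normrN => Mt.
by have := le_lt_trans (tM n t St) (le_lt_trans (ler_norm _) Mt); rewrite ltxx.
Qed.

Lemma middle_cantorP (R : realType) (eps : R) :
  0 < eps < 1 -> is_cantor_attractor eps (middle_cantor eps).
Proof.
move=> e01; have [C hC] := exists_cantor_attractor e01.
by rewrite /middle_cantor; case: xgetP => [D _ //|/(_ C)].
Qed.

Lemma cantor_ratio_bounds (R : realType) (eps : R) :
  0 < eps < 1 -> 0 < cantor_ratio eps < 1 / 2.
Proof. by rewrite /cantor_ratio => /andP[e0 e1]; apply/andP; split; lra. Qed.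

(** * Points of the attractor and rescaling of progressions *)

Section Attractor.
Variables (R : realType) (eps : R) (C : set R).
Hypotheses (e01 : 0 < eps < 1) (CP : is_cantor_attractor eps C).
Local Notation l := (cantor_ratio eps).

Lemma attractor_map x : C x -> C (l * x) /\ C (1 - l + l * x).
Proof.
case: CP => _ _ CE Cx.
by split; rewrite CE; [left | right]; exists x.
Qed.

Lemma attractor_inv x :
  C x -> exists2 y, C y & x = l * y \/ x = 1 - l + l * y.
Proof.
case: CP => _ _ CE; rewrite {1}CE => -[] [y Cy <-]; exists y => //;
  by [left | right].
Qed.

(** A point of [C] at distance [t] outside the unit interval is the image of one at distance at
    least [t / l] on the same side, while compactness bounds these distances. *)
Lemma attractor_itv x : C x -> 0 <= x <= 1.
Proof.
have /andP[l0 l1] := cantor_ratio_bounds e01.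
have l01 : 0 < l < 1 by rewrite l0; lra.
have [M CM] : exists M, forall y, C y -> `|y| <= M.
  case: CP => _ cC _; have [M [_ HM]] := compact_bounded cC.
  exists (`|M| + 1) => y Cy; apply: HM => //.
  by rewrite (le_lt_trans (ler_norm M)) // ltrDl.
move=> Cx; apply/andP; split; rewrite leNgt; apply/negP => xout.
- have /seteqP[+ _] : [set t | 0 < t /\ C (- t)] = set0.
    apply: (@expanding_set_empty _ l M) => // [t [t0 /CM]|t [t0 /attractor_inv]].
      by rewrite normrN t0 gtr0_norm.
    by case=> y Cy ty; exists (- y); [split; rewrite ?opprK //|];
      case: ty => ty; nra.
  by move=> /(_ (- x)); apply; rewrite /= opprK oppr_gt0.
- have /seteqP[+ _] : [set t | 0 < t /\ C (1 + t)] = set0.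
    apply: (@expanding_set_empty _ l M) => // [t [t0 /CM]|t [t0 /attractor_inv]].
      by move=> tM; rewrite t0 /=; have := ler_norm (1 + t); lra.
    case=> y Cy ty; exists (y - 1); last by case: ty => ty; nra.
    by split; [case: ty => ty; nra | rewrite addrC subrK].
  by move=> /(_ (x - 1)); apply; rewrite /= subr_gt0 addrC subrK.
Qed.

(** The orbit of any point of [C] under this contraction stays in the closed set [C] and converges
    to [p]. It serves for 0 and 1, the fixed points of the two maps. *)
Lemma attractor_fixpoint p : (forall x, C x -> C (p + l * (x - p))) -> C p.
Proof.
have /andP[l0 l1] := cantor_ratio_bounds e01.
have [[x0 Cx0] cC _] := CP => Cp.
have Cn n : C (p + geometric (x0 - p) l n).
  elim: n => [|n IH]; first by rewrite /geometric /= expr0 mulr1 addrC subrK.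
  have := Cp _ IH; rewrite addrAC subrr add0r.
  by rewrite /geometric /= exprS mulrCA.
have clC : closed C by apply: compact_closed cC; exact: Rhausdorff.
apply: (@closed_cvg _ _ \oo _ (fun n => p + geometric (x0 - p) l n) _ clC).
  exact: nearW.
rewrite -[X in _ --> X]addr0; apply: cvgD; first exact: cvg_cst.
by apply: cvg_geometric; rewrite gtr0_norm //; lra.
Qed.

Lemma attractor0 : C 0.
Proof.
by apply: attractor_fixpoint => x /attractor_map[+ _]; rewrite subr0 add0r.
Qed.

Lemma attractor1 : C 1.
Proof.
apply: attractor_fixpoint => x /attractor_map[_].
by rewrite mulrBr mulr1 addrA addrAC.
Qed.

Lemma attractor_gap x : C x -> x <= l \/ 1 - l <= x.
Proof.
have /andP[l0 l1] := cantor_ratio_bounds e01.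
by move=> /attractor_inv[y /attractor_itv/andP[y0 y1] []->]; [left|right]; nra.
Qed.

(** Since [l < 1 / 2], the two pieces are disjoint, so the position of [x] decides which map
    produced it. *)
Lemma attractor_left x : C x -> x <= l -> C (x / l).
Proof.
have /andP[l0 l1] := cantor_ratio_bounds e01.
move=> /attractor_inv[y Cy [->|->]] xl; first by rewrite mulrC mulKf // gt_eqF.
by have /andP[y0 y1] := attractor_itv Cy; exfalso; nra.
Qed.

Lemma attractor_right x : C x -> 1 - l <= x -> C ((x - (1 - l)) / l).
Proof.
have /andP[l0 l1] := cantor_ratio_bounds e01.
move=> /attractor_inv[y Cy [->|->]] xl.
  by have /andP[y0 y1] := attractor_itv Cy; exfalso; nra.
by rewrite addrC addKr mulrC mulKf // gt_eqF.
Qed.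

Lemma gAP_le1 k t : (1 < k)%N -> gAP k C t -> 0 < t <= 1.
Proof.
move=> k1 [t0 [x Cx]].
have := attractor_itv (Cx 0%N (ltnW k1)); have := attractor_itv (Cx 1%N k1).
by rewrite mulr0n mulr1n t0 => /andP[? ?] /andP[? ?] /=; lra.
Qed.

Lemma gAP_contract k t : gAP k C t -> gAP k C (l * t).
Proof.
have /andP[l0 _] := cantor_ratio_bounds e01.
move=> [t0 [x Cx]]; split; first exact: mulr_gt0.
exists (l * x) => j jk; rewrite -mulrnAr -mulrDr.
by have [] := attractor_map (Cx j jk).
Qed.

(** Crossing the gap gives [t >= 1 - 2 * l >= 1 / 3 >= l]. A third term on either side must fit in
    the same piece as its neighbour, so [t <= l], and all these are equalities. *)
Lemma gap_crossing_triple x t :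
  1 / 3 <= eps -> 0 < t -> C x -> C (x + t) -> C (x - t) \/ C (x + t *+ 2) ->
  x <= l -> 1 - l <= x + t -> l = 1 / 3 /\ t = 1 / 3.
Proof.
move=> e3 t0 Cx Cxt C3 xl xr.
have l3 : l <= 1 / 3 by rewrite /cantor_ratio; lra.
have /andP[x0 _] := attractor_itv Cx; have /andP[_ x1] := attractor_itv Cxt.
case: C3 => /attractor_itv/andP[y0 y1]; rewrite ?mulr2n in y0 y1.
  by split; lra.
by split; lra.
Qed.

(** Outside the exceptional case no two consecutive terms straddle the gap, so all terms share the
    piece of the first one; inverting the map of that piece divides the step by [l]. *)
Lemma gAP_expand k t :
  1 / 3 <= eps -> (3 <= k)%N -> gAP k C t ->
  (l = 1 / 3 /\ t = 1 / 3) \/ gAP k C (t / l).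
Proof.
move=> e3 k3 [t0 [x Cx]].
have /andP[l0 l1] := cantor_ratio_bounds e01.
have [?|n3] := pselect (l = 1 / 3 /\ t = 1 / 3); [by left | right].
split; first exact: divr_gt0.
have step j : (j.+1 < k)%N -> x + t *+ j <= l -> x + t *+ j.+1 <= l.
  move=> jk xl; have Cj := Cx j (ltnW jk); have Cj1 := Cx _ jk.
  have [//|xr] := attractor_gap Cj1.
  case: n3; apply: (@gap_crossing_triple (x + t *+ j)) => //.
  - by rewrite -addrA -mulrSr.
  (* The third term is the predecessor, except at [j = 0], where [3 <= k] supplies the term after
     the crossing. *)
  - case: j jk xl Cj Cj1 xr => [|j] jk _ _ _ _.
      by right; rewrite mulr0n addr0; exact: Cx.
    by left; rewrite mulrSr addrA addrK; apply: Cx; do 2 apply: ltnW.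
  - by rewrite -addrA -mulrSr.
have [xl|xr] := attractor_gap (Cx 0%N (ltnW (ltnW k3))).
- exists (x / l) => j jk.
  rewrite -mulrnAl -mulrDl; apply: attractor_left; first exact: Cx.
  by elim: j jk => // j IH jk; apply: step => //; exact/IH/ltnW.
- exists ((x - (1 - l)) / l) => j jk.
  rewrite -mulrnAl -mulrDl addrAC; apply: attractor_right; first exact: Cx.
  (* The step is positive, so a progression starting in the right piece never leaves it. *)
  have tj : 0 <= t *+ j by rewrite mulrn_wge0 // ltW.
  by move: xr; rewrite mulr0n; lra.
Qed.

Lemma gAP_empty k :
  1 / 3 <= eps -> (3 <= k)%N ->
  (forall t, gAP k C t -> ~ (l = 1 / 3 /\ t = 1 / 3)) -> gAP k C = set0.
Proof.
move=> e3 k3 nt; have /andP[l0 l1] := cantor_ratio_bounds e01.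
apply: (@expanding_set_empty _ l 1) => [|t Gt|t Gt]; first by rewrite l0; lra.
  by apply: gAP_le1 Gt; exact: leq_trans k3.
have [/(nt _ Gt)//|Gtl] := gAP_expand e3 k3 Gt.
by exists (t / l) => //; rewrite mulrC divfK // gt_eqF.
Qed.

End Attractor.

Lemma gAP_subset (R : realType) (k m : nat) (C : set R) :
  (m <= k)%N -> gAP k C `<=` gAP m C.
Proof.
move=> mk t [t0 [x Cx]]; split=> //; exists x => j jm.
exact/Cx/(leq_trans jm mk).
Qed.

(** * The middle-third Cantor set *)

Section MiddleThird.
Variables (R : realType) (C : set R).
Hypothesis CP : is_cantor_attractor (1 / 3) C.

Let e01 : 0 < (1 / 3 : R) < 1.
Proof. by apply/andP; split; lra. Qed.

Let ratioE : cantor_ratio (1 / 3 : R) = 3^-1.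
Proof. by rewrite /cantor_ratio; lra. Qed.

(** The steps that are not such powers form an expanding set: the exceptional step is [3 ^- 1], and
    if [u * 3] is a power then so is [u], with exponent one larger. *)
Lemma gAP3_third t : gAP 3 C t -> exists2 n : nat, (1 <= n)%N & 3 ^- n = t.
Proof.
move=> Gt; apply: contrapT => nt.
have /seteqP[+ _] :
    [set u | gAP 3 C u /\ ~ exists2 n : nat, (1 <= n)%N & 3 ^- n = u] = set0.
  apply: (@expanding_set_empty _ 3^-1 1) => [|u [Gu _]|u [Gu nu]].
  - by apply/andP; split; lra.
  - exact: (gAP_le1 e01 CP _ Gu).
  - have [[_ u3]|Gu3] := gAP_expand e01 CP (lexx _) (leqnn 3) Gu.
      by case: nu; exists 1%N => //; rewrite expr1 u3; lra.
    move: Gu3; rewrite ratioE invrK => Gu3.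
    exists (u * 3); last by lra.
    split=> // -[n n1 nE]; apply: nu; exists n.+1 => //.
    by rewrite exprS invfM nE; lra.
by move=> /(_ t); apply.
Qed.

(** The progression 0, 1/3, 2/3, 1 consists of the images of 0 and 1 under the two maps; contracting
    it gives the smaller steps. *)
Lemma gAP4_third n : gAP 4 C (3 ^- n.+1).
Proof.
elim: n => [|n IH]; last first.
  by rewrite exprS invfM -ratioE; exact: gAP_contract.
have [C3 C23] := attractor_map CP (attractor0 e01 CP).
have [C13 _] := attractor_map CP (attractor1 e01 CP).
have C1 := attractor1 e01 CP.
rewrite expr1; split; first by lra.
exists 0 => -[|[|[|[|//]]]] _.
- by rewrite mulr0n addr0; exact: attractor0 e01 CP.
- by move: C13; rewrite ratioE mulr1 add0r.
- by move: C23; rewrite ratioE; congr C; lra.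
- by move: C1; congr C; lra.
Qed.

(** Only the step 1/3 has to be excluded, and five terms with that step span 4/3, more than the unit
    interval. *)
Lemma gAP5_third : gAP 5 C = set0.
Proof.
apply: (gAP_empty e01 CP) => // t [t0 [x Cx]] [_ tE].
have := attractor_itv e01 CP (Cx 0%N isT).
have := attractor_itv e01 CP (Cx 4%N isT).
by rewrite tE => /andP[? ?] /andP[? ?]; lra.
Qed.

End MiddleThird.

Theorem proposition2p1 (R : realType) :
  [/\ gAP 4 (middle_cantor (1 / 3 : R)) = gAP 3 (middle_cantor (1 / 3 : R)),
      gAP 3 (middle_cantor (1 / 3 : R)) = [set 3 ^- n | n in [set n : nat | (1 <= n)%N]],
      forall k : nat, (5 <= k)%N -> gAP k (middle_cantor (1 / 3 : R)) = set0
    & forall eps : R, 1 / 3 < eps -> eps < 1 -> gAP 3 (middle_cantor eps) = set0].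
Proof.
have CP : is_cantor_attractor (1 / 3) (middle_cantor (1 / 3 : R)).
  by apply: middle_cantorP; apply/andP; split; lra.
split.
- apply/seteqP; split; first exact: gAP_subset.
  by move=> t /(gAP3_third CP)[[//|n] _ <-]; exact: gAP4_third.
- apply/seteqP; split=> t; first exact: gAP3_third.
  by case=> -[//|n] _ <-; apply: (@gAP_subset _ 4) => //; exact: gAP4_third.
- move=> k k5; apply/seteqP; split=> // t /(gAP_subset k5).
  by rewrite (gAP5_third CP).
- move=> eps e3 e1; have e01 : 0 < eps < 1 by apply/andP; split; lra.
  apply: (gAP_empty e01 (middle_cantorP e01)) => //; first exact: ltW.
  (* The exceptional case needs ratio 1/3, but [1 / 3 < eps] makes the ratio smaller. *)
  by move=> t _ []; rewrite /cantor_ratio; lra.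
Qed.
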